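(* Let $K$ be an algebraically closed field of characteristic $p>0$ with $p\neq 2$, and let $n>3$. Let $\Phi$ be a group automorphism of $\mathrm{Aut}_0 K[x_1,\ldots,x_n]$ which fixes every element of the standard torus $T^n$, i.e. $\Phi(\sigma_\lambda)=\sigma_\lambda$ for every $\lambda=(\lambda_1,\ldots,\lambda_n)\in (K^\times)^n$, where $\sigma_\lambda$ is the automorphism $x_i\mapsto \lambda_i x_i$ ($i=1,\ldots,n$). Then there exists a linear automorphism $S\in \mathrm{GL}_n(K)$ such that the map $\varphi\mapsto S\circ\Phi(\varphi)\circ S^{-1}$ fixes every (origin-preserving) elementary automorphism.
   Context: $\mathrm{Aut}_0 K[x_1,\ldots,x_n]$ denotes the group (under composition) of $K$-algebra automorphisms $\varphi$ of the polynomial algebra $K[x_1,\ldots,x_n]$ that preserve the origin, i.e. each $\varphi(x_i)$ has zero constant term. $\mathrm{GL}_n(K)\subset \mathrm{Aut}_0K[x_1,\ldots,x_n]$ is the subgroup of linear automorphisms $x_i\mapsto \sum_j a_{ij}x_j$ with $(a_{ij})$ invertible. An (origin-preserving) elementary automorphism is one of the form $x_i\mapsto x_i+P(x_1,\ldots,\hat{x}_i,\ldots,x_n)$, $x_k\mapsto x_k$ for $k\neq i$, where $P$ does not depend on $x_i$ and has zero constant term. *)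

(* Defs.v *)
From HB Require Import structures.
From mathcomp Require Import all_boot all_order all_algebra.
From mathcomp Require Import mpoly.
Set Implicit Arguments. Unset Strict Implicit. Unset Printing Implicit Defensive.
Import GRing.Theory.
Local Open Scope ring_scope.

(* A K-algebra endomorphism of K[x_1..x_n] is determined by the images of
   the variables: endo K n := n-tuple (phi(x_1), ..., phi(x_n)). *)
Definition endo (K : fieldType) (n : nat) := n.-tuple {mpoly K[n]}.

(* composition (f o g)(x_i) = f(g(x_i)) = g(x_i)(f(x_1),...,f(x_n)) *)
Definition ecomp (K : fieldType) (n : nat) (f g : endo K n) : endo K n :=
  [tuple comp_mpoly f (tnth g i) | i < n].

Definition eid (K : fieldType) (n : nat) : endo K n := [tuple 'X_i | i < n].

Definition is_aut0 (K : fieldType) (n : nat) (f : endo K n) : Prop :=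
  (exists g : endo K n, ecomp f g = eid K n /\ ecomp g f = eid K n) /\
  (forall i : 'I_n, mcoeff 0%MM (tnth f i) = 0).

(* Phi is a group automorphism of Aut_0 K[x_1..x_n] (values of Phi outside
   Aut_0 are irrelevant). *)
Definition is_group_aut_aut0 (K : fieldType) (n : nat)
    (Phi : endo K n -> endo K n) : Prop :=
  [/\ (forall f, is_aut0 f -> is_aut0 (Phi f)),
      (forall f g, is_aut0 f -> is_aut0 g -> Phi (ecomp f g) = ecomp (Phi f) (Phi g)),
      (forall f g, is_aut0 f -> is_aut0 g -> Phi f = Phi g -> f = g) &
      (forall h, is_aut0 h -> exists2 f, is_aut0 f & Phi f = h)].

Definition torus (K : fieldType) (n : nat) (lam : 'I_n -> K) : endo K n :=
  [tuple lam i *: 'X_i | i < n].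

Definition linaut (K : fieldType) (n : nat) (A : 'M[K]_n) : endo K n :=
  [tuple \sum_(j < n) A i j *: 'X_j | i < n].

Definition elem (K : fieldType) (n : nat) (i : 'I_n) (P : {mpoly K[n]}) : endo K n :=
  [tuple if j == i then 'X_j + P else 'X_j | j < n].

Definition elem_ok (K : fieldType) (n : nat) (i : 'I_n) (P : {mpoly K[n]}) : Prop :=
  (forall m, m \in msupp P -> m i = 0%N) /\ mcoeff 0%MM P = 0.

(* Main.v *)
Require Import Defs.
From HB Require Import structures.
From mathcomp Require Import all_boot all_order all_algebra.
From mathcomp Require Import mpoly.
From mathcomp Require Import ring zify.
Set Implicit Arguments. Unset Strict Implicit. Unset Printing Implicit Defensive.
Import GRing.Theory.
Local Open Scope ring_scope.

(* Write [u_(i,m)(c)] for the shear [x_i |-> x_i + c x^m], [m_i = 0], [m <> 0].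
   It commutes with the subtorus [lam^m = lam_i], and so does its image under
   Phi; this forces the image to be diagonal up to a multiple of [x^m] in the
   i-th component (and up to a transposed term when [m] is linear, which is
   excluded because the shear commutes with [u_(i,2e_k)]). Comparing
   [u(c) u(c) = u(2c)] and [u(c) u(-c) = 1] with torus conjugation makes the
   diagonal part trivial, so Phi maps [u_(i,m)(c)] to [u_(i,m)(b_(i,m) c)].
   Conjugating [u_(i,m + r e_j)] by [u_(j,q)] yields
   [b_(i,m + r q) = b_(i,m + r e_j) * b_(j,q)^r], whose only solutions are
   [b_(i,m) = lam^m / lam_i] for some [lam] in the torus; so Phi acts on
   elementary automorphisms as conjugation by [lam]. *)

(** * Powers, indices and exponents *)

(** An algebraically closed field is infinite, so a nonzero polynomial has a nonroot; the extra
    factor ['X] makes that nonroot nonzero. *)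
Lemma expr_inj_closed (K : closedFieldType) (a b : nat) :
  (forall t : K, t != 0 -> t ^+ a = t ^+ b) -> a = b.
Proof.
move=> tab; apply/eqP/negPn/negP => nab.
have nz : 'X * ('X^a - 'X^b) != 0 :> {poly K}.
  rewrite mulf_neq0 ?polyX_eq0 // subr_eq0; apply: contra nab => /eqP eX.
  by rewrite -eqSS -(size_polyXn K a) -(size_polyXn K b) eX.
have [t] := closed_nonrootP _ nz; rewrite rootM negb_or rootX => /andP[t0].
by rewrite /root !hornerE tab // subrr eqxx.
Qed.

Lemma exists_third (n : nat) (i j : 'I_n) :
  (2 < n)%N -> exists k : 'I_n, (k != i) && (k != j).
Proof.
move=> n3; have /subsetPn[k _] : ~~ ([set: 'I_n] \subset [set i; j]).
  apply: contraL n3 => /subset_leq_card; rewrite cardsT card_ord -leqNgt.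
  by move=> /leq_trans; apply; rewrite cards2; case: (_ != _).
by rewrite !inE negb_or => kij; exists k.
Qed.

Lemma mnm_neq0P (n : nat) (m : 'X_{1..n}) : reflect (exists k, m k != 0%N) (m != 0%MM).
Proof.
apply: (iffP idP) => [m0|[k mk]]; last by apply: contraNneq mk => ->; rewrite mnm0E.
apply/existsP; apply: contraR m0 => /existsPn m0; apply/eqP/mnmP => k.
by rewrite mnm0E; apply/eqP; have := m0 k; rewrite negbK.
Qed.

(** * Composition of torus elements and elementary automorphisms *)

Section Endomorphisms.
Variables (K : fieldType) (n : nat).
Implicit Types (f g : endo K n) (i j k : 'I_n) (m a : 'X_{1..n}).
Implicit Types (lam : 'I_n -> K) (P Q : {mpoly K[n]}).

Lemma tnth_ecomp f g j : tnth (ecomp f g) j = tnth g j \mPo f.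
Proof. by rewrite tnth_mktuple. Qed.

Lemma tnth_torus lam j : tnth (torus lam) j = lam j *: 'X_j.
Proof. by rewrite tnth_mktuple. Qed.

Lemma tnth_eid j : tnth (eid K n) j = 'X_j.
Proof. by rewrite tnth_mktuple. Qed.

Lemma tnth_elem i P j :
  tnth (elem i P) j = if j == i then 'X_j + P else 'X_j.
Proof. by rewrite tnth_mktuple. Qed.

Lemma comp_mpolyXt f i : 'X_i \mPo f = tnth f i.
Proof. by rewrite comp_mpolyXU -tnth_nth. Qed.

Lemma torus1 : torus (fun=> 1 : K) = eid K n.
Proof. by apply: eq_from_tnth => j; rewrite tnth_torus tnth_eid scale1r. Qed.

Lemma elem0 i : elem i 0 = eid K n.
Proof.
by apply: eq_from_tnth => j; rewrite tnth_elem tnth_eid addr0 if_same.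
Qed.

Lemma elem_inj i : injective (@elem K n i).
Proof.
move=> P Q /(congr1 (fun f => tnth f i)).
by rewrite !tnth_elem eqxx => /addrI.
Qed.

(** The [i]-th component of [f] is left free because ['X_[m]] never sees it; this covers torus
    elements, shears and images of shears at once. *)
Lemma comp_monomial_diag i m f lam : m i = 0%N ->
    (forall k, k != i -> tnth f k = lam k *: 'X_k) ->
  'X_[m] \mPo f = mmap1 lam m *: 'X_[m].
Proof.
move=> mi0 fk; rewrite comp_mpolyX [in RHS]mpolyXE_id /mmap1 -scaler_prod.
apply: eq_bigr => k _; have [->|ki] := eqVneq k i.
  by rewrite mi0 !expr0 scale1r.
by rewrite fk // exprZn.
Qed.

Lemma mcoeff_comp_torus lam P a :
  (P \mPo torus lam)@_a = mmap1 lam a * P@_a.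
Proof.
rewrite comp_mpolyEX [in RHS](mpolyE P) !raddf_sum /= mulr_sumr.
apply: eq_bigr => m _; rewrite comp_mpolyX.
under eq_bigr do rewrite tnth_torus exprZn.
rewrite scaler_prod -mpolyXE_id !mcoeffZ mcoeffX.
by have [->|_] := eqVneq m a; rewrite ?mulr1 ?mulr0 // mulrC.
Qed.

Lemma comp_elem_free i P Q :
  (forall m, m \in msupp P -> m i = 0%N) -> P \mPo elem i Q = P.
Proof.
move=> Pi; rewrite comp_mpolyEX [in RHS](mpolyE P); apply: eq_big_seq => m mP.
congr (_ *: _); rewrite (@comp_monomial_diag i _ _ (fun=> 1)) ?Pi //.
  by rewrite /mmap1 big1 ?scale1r // => k _; rewrite expr1n.
by move=> k ki; rewrite tnth_elem (negPf ki) scale1r.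
Qed.

Lemma ecomp_elem i P Q : elem_ok i Q ->
  ecomp (elem i P) (elem i Q) = elem i (P + Q).
Proof.
move=> [Qi _]; apply: eq_from_tnth => j; rewrite tnth_ecomp !tnth_elem.
have [->|ji] := eqVneq j i; last by rewrite comp_mpolyXt tnth_elem (negPf ji).
by rewrite comp_mpolyD comp_mpolyXt tnth_elem eqxx comp_elem_free // addrA.
Qed.

Lemma elem_okP i P :
  elem_ok i P <-> (forall m, m i != 0%N -> P@_m = 0) /\ P@_0%MM = 0.
Proof.
split=> -[Pi P0]; split=> // m.
  by apply: contraNeq; rewrite -mcoeff_msupp => /Pi ->.
by rewrite mcoeff_msupp => /eqP Pm; apply/eqP/negPn/negP => /Pi.
Qed.

Lemma elem_okX i (c : K) m : m i = 0%N -> m != 0%MM -> elem_ok i (c *: 'X_[m]).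
Proof.
move=> mi m0; apply/elem_okP; split=> [a ai|]; rewrite mcoeffZ mcoeffX.
  by have [e|_] := eqVneq m a; [rewrite -e mi in ai | rewrite mulr0].
by rewrite (negPf m0) mulr0.
Qed.

Lemma elem_okD i P Q : elem_ok i P -> elem_ok i Q -> elem_ok i (P + Q).
Proof.
move=> /elem_okP[Pi P0] /elem_okP[Qi Q0]; apply/elem_okP; split=> [m mi|].
  by rewrite mcoeffD Pi // Qi // addr0.
by rewrite mcoeffD P0 Q0 addr0.
Qed.

Lemma elem_okN i P : elem_ok i P -> elem_ok i (- P).
Proof.
move=> /elem_okP[Pi P0]; apply/elem_okP; split=> [m mi|].
  by rewrite mcoeffN Pi ?oppr0.
by rewrite mcoeffN P0 oppr0.
Qed.

Lemma elem_ok0 i : elem_ok i (0 : {mpoly K[n]}).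
Proof. by apply/elem_okP; split=> *; rewrite mcoeff0. Qed.

Lemma mcoeff0XU i : ('X_i : {mpoly K[n]})@_0%MM = 0.
Proof. by rewrite mcoeffX mnm1_eq0. Qed.

Lemma is_aut0_elem i P : elem_ok i P -> is_aut0 (elem i P).
Proof.
move=> okP; split=> [|j].
  exists (elem i (- P)); rewrite !ecomp_elem ?addrN ?addNr ?elem0 //.
  exact: elem_okN.
by rewrite tnth_elem; case: ifP => _; rewrite ?mcoeffD mcoeff0XU // okP.2 addr0.
Qed.

Lemma ecomp_torus lam mu : (forall j, mu j * lam j = 1) ->
  ecomp (torus lam) (torus mu) = eid K n.
Proof.
move=> lm; apply: eq_from_tnth => j; rewrite tnth_ecomp !tnth_torus tnth_eid.
by rewrite comp_mpolyZ comp_mpolyXt tnth_torus scalerA lm scale1r.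
Qed.

Lemma is_aut0_torus lam : (forall j, lam j != 0) -> is_aut0 (torus lam).
Proof.
move=> l0; split=> [|j]; last by rewrite tnth_torus mcoeffZ mcoeff0XU mulr0.
exists (torus (fun j => (lam j)^-1)).
by split; apply: ecomp_torus => j; rewrite ?mulVf ?mulfV.
Qed.

Lemma mmap1_neq0 lam m : (forall j, lam j != 0) -> mmap1 lam m != 0.
Proof. by move=> l0; apply/prodf_neq0 => j _; rewrite expf_neq0. Qed.

Lemma torus_elem lam i c m : lam i != 0 ->
  ecomp (torus lam) (elem i (c *: 'X_[m])) =
  ecomp (elem i ((c * mmap1 lam m / lam i) *: 'X_[m])) (torus lam).
Proof.
move=> li; apply: eq_from_tnth => j; rewrite !tnth_ecomp tnth_torus tnth_elem.
have [->|ji] := eqVneq j i; last first.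
  by rewrite comp_mpolyZ !comp_mpolyXt tnth_torus tnth_elem (negPf ji).
apply/mpolyP => a; rewrite mcoeff_comp_torus comp_mpolyZ comp_mpolyXt.
rewrite tnth_elem eqxx !mcoeffZ !mcoeffD !mcoeffZ !mcoeffX.
have -> : mmap1 lam a * ((U_(i)%MM == a)%:R + c * (m == a)%:R) =
  (U_(i)%MM == a)%:R * mmap1 lam a + c * ((m == a)%:R * mmap1 lam a) by ring.
have -> : (U_(i)%MM == a)%:R * mmap1 lam a = (U_(i)%MM == a)%:R * lam i.
  by have [<-|] := eqVneq U_(i)%MM a; rewrite ?mul0r // mmap1U.
have -> : (m == a)%:R * mmap1 lam a = (m == a)%:R * mmap1 lam m.
  by have [<-|] := eqVneq m a; rewrite ?mul0r.
by field.
Qed.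

(** As [Q] is free of ['X_i], conjugation only substitutes ['X_j + Q] for ['X_j] inside [P]. The
    relation is used both before and after applying [Phi]. *)
Lemma elem_conj i j P Q : i != j -> elem_ok i Q ->
  ecomp (elem j Q) (elem i P) = ecomp (elem i (P \mPo elem j Q)) (elem j Q).
Proof.
move=> ij [Qi _]; apply: eq_from_tnth => k; rewrite !tnth_ecomp !tnth_elem.
have [->|ki] := eqVneq k i.
  by rewrite comp_mpolyD (negPf ij) !comp_mpolyXt !tnth_elem eqxx (negPf ij).
have [->|kj] := eqVneq k j.
  rewrite comp_mpolyD !comp_mpolyXt !tnth_elem eqxx eq_sym (negPf ij).
  by rewrite comp_elem_free.
by rewrite !comp_mpolyXt !tnth_elem (negPf ki) (negPf kj).
Qed.

Lemma comp_monomial_elem j (c : K) q m r : m j = 0%N ->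
  'X_[m + U_(j) *+ r] \mPo elem j (c *: 'X_[q]) =
  \sum_(k < r.+1)
    (c ^+ k *+ 'C(r, k)) *: 'X_[m + U_(j) *+ (r - k) + q *+ k].
Proof.
move=> mj; rewrite mpolyXD rmorphM /=.
rewrite (@comp_monomial_diag j _ _ (fun=> 1)) //; last first.
  by move=> k kj; rewrite tnth_elem (negPf kj) scale1r.
rewrite /mmap1 big1 => [|k _]; last by rewrite expr1n.
rewrite scale1r -mpolyXn rmorphXn /= comp_mpolyXt tnth_elem eqxx exprDn mulr_sumr.
apply: eq_bigr => k _; rewrite exprZn !mpolyXn !mpolyXD.
by rewrite mulrnAr -!scalerAr scalerMnl mulrA.
Qed.

End Endomorphisms.

(** * The multiplicative relations between weights and their solutions *)

Section Cocycle.
Variables (K : fieldType) (n : nat).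
Implicit Types (i j k : 'I_n) (m q : 'X_{1..n}) (lam : 'I_n -> K).

Lemma mmap1DMn lam m q r :
  mmap1 lam (m + q *+ r)%MM = mmap1 lam m * mmap1 lam q ^+ r.
Proof.
rewrite /mmap1 -prodrXl -big_split /=; apply: eq_bigr => k _.
by rewrite mnmDE mulmnE exprD exprM.
Qed.

Lemma mmap1Mn lam m r : mmap1 lam (m *+ r)%MM = mmap1 lam m ^+ r.
Proof. by rewrite -[(m *+ r)%MM]add0m mmap1DMn mmap11 mul1r. Qed.

Variable b : 'I_n -> 'X_{1..n} -> K.
Hypothesis n_gt2 : (2 < n)%N.
Hypothesis b_neq0 : forall i m, m i = 0%N -> m != 0%MM -> b i m != 0.
Hypothesis b_subst : forall i j m q r, i != j ->
  m i = 0%N -> m j = 0%N -> q i = 0%N -> q j = 0%N -> q != 0%MM ->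
  (m + U_(j) *+ r)%MM != 0%MM ->
  b i (m + q *+ r)%MM = b i (m + U_(j) *+ r)%MM * b j q ^+ r.

Let mulU_neq0 k r : (0 < r)%N -> (U_(k) *+ r : 'X_{1..n})%MM != 0%MM.
Proof. by move=> r0; rewrite -mdeg_eq0 mdegMn mdeg1 mul1n -lt0n. Qed.

Let U_neq0 k : U_(k)%MM != 0%MM :> 'X_{1..n}.
Proof. by rewrite mnm1_eq0. Qed.

Let mulU_out k i r : i != k -> (U_(k) *+ r : 'X_{1..n})%MM i = 0%N.
Proof. by move=> ik; rewrite mulmnE mnm1E eq_sym (negPf ik). Qed.

Let U_out k i : i != k -> (U_(k) : 'X_{1..n})%MM i = 0%N.
Proof. by move=> ik; rewrite mnm1E eq_sym (negPf ik). Qed.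

(* Solves the relation of weights: [lam_k = b_(i,2e_k) / b_(i,e_k)]. After
   dividing [b] by [lam^m / lam_i], substituting [q = e_k] merges the variables
   of [m] into one, and the remaining powers are treated by induction. *)
Lemma cocycle_coboundary : exists2 lam : 'I_n -> K, (forall k, lam k != 0) &
  forall i m, m i = 0%N -> m != 0%MM -> b i m = mmap1 lam m / lam i.
Proof.
(* An arbitrary index other than [k]; the default value is never taken, by [o_neq]. *)
pose o k := odflt k [pick i | i != k].
have o_neq k : o k != k.
  rewrite /o; case: pickP => [i //|nk]; have [i /andP[ik _]] := exists_third k k n_gt2.
  by rewrite nk in ik.
pose lam k := b (o k) (U_(k) *+ 2)%MM / b (o k) U_(k)%MM.
have lam_neq0 k : lam k != 0.
  by rewrite mulf_neq0 ?invr_eq0 ?b_neq0 ?mulU_out ?U_out ?mulU_neq0.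
have b_lin i j q : i != j -> q i = 0%N -> q j = 0%N -> q != 0%MM ->
    b i q = b i U_(j)%MM * b j q.
  move=> ij qi qj q0; have := @b_subst i j 0%MM q 1 ij.
  by rewrite !mnm0E !add0m !mulm1n expr1; apply.
(* The ratio does not depend on the row: by [b_lin], passing from row [o k] to row [i] multiplies
   numerator and denominator by the same factor. *)
have lamE i k : i != k -> lam k = b i (U_(k) *+ 2)%MM / b i U_(k)%MM.
  move=> ik; rewrite /lam; have [->//|oi] := eqVneq i (o k).
  rewrite (@b_lin i (o k)) ?mulU_out ?mulU_neq0 //.
  rewrite (@b_lin i (o k) U_(k)%MM) ?U_out //.
  by field; rewrite !b_neq0 ?U_out.
clearbody lam.
(* Both sides are computed in a third row [j]: replacing the variable [i] by [k] costs
   [b i U_(k) ^+ 2] in the numerator and [b i U_(k)] in the denominator. *)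
have lam_lin i k : i != k -> lam k = lam i * b i U_(k)%MM.
  move=> ik; have [j /andP[ji jk]] := exists_third i k n_gt2.
  rewrite (lamE _ _ ji) (lamE _ _ jk) (b_lin j i U_(k)%MM) ?U_out //.
  have := @b_subst j i 0%MM U_(k)%MM 2 ji.
  rewrite !mnm0E !add0m => -> //; rewrite ?U_out ?mulU_neq0 //.
  by field; rewrite !b_neq0 ?U_out.
pose c i m := b i m * lam i / mmap1 lam m.
have c_subst i j m q r : i != j ->
    m i = 0%N -> m j = 0%N -> q i = 0%N -> q j = 0%N -> q != 0%MM ->
    (m + U_(j) *+ r)%MM != 0%MM ->
    c i (m + q *+ r)%MM = c i (m + U_(j) *+ r)%MM * c j q ^+ r.
  move=> ij mi mj qi qj q0 mr0; rewrite /c (b_subst ij) // !mmap1DMn mmap1U.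
  rewrite !exprMn !exprVn.
  field.
  by rewrite !expf_neq0 ?mmap1_neq0.
have c_lin i k : i != k -> c i U_(k)%MM = 1.
  move=> ik; rewrite /c mmap1U (lam_lin _ _ ik).
  by field; rewrite lam_neq0 b_neq0 ?U_out.
have c_merge i j k m r : i != j -> i != k -> j != k ->
    m i = 0%N -> m j = 0%N -> (m + U_(j) *+ r)%MM != 0%MM ->
    c i (m + U_(k) *+ r)%MM = c i (m + U_(j) *+ r)%MM.
  move=> ij ik jk mi mj m0.
  by rewrite (@c_subst i j) ?U_out // c_lin // expr1n mulr1.
have c_sqr i k : i != k -> c i (U_(k) *+ 2)%MM = 1.
  move=> ik; rewrite /c mmap1Mn mmap1U.
  have -> : b i (U_(k) *+ 2)%MM = lam k * b i U_(k)%MM.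
    by rewrite (lamE _ _ ik) divfK // b_neq0 ?U_out.
  rewrite (lam_lin _ _ ik).
  by field; rewrite lam_neq0 b_neq0 ?U_out.
have c_pow k d i : i != k -> c i (U_(k) *+ d.+1)%MM = 1.
  elim: d i => [|d IH] i ik; first by rewrite mulm1n c_lin.
  have [j /andP[ji jk]] := exists_third i k n_gt2.
  have ij : i != j by rewrite eq_sym.
  have nz : (U_(k) + U_(j) *+ 1)%MM != 0%MM :> 'X_{1..n}.
    by rewrite mnmD_eq0 mnm1_eq0.
  (* Substituting the power [d.+1] of the variable [k] for [j] in the product of the two gives the
     power [d.+2]; the remaining factor, at that product, merges into a square. *)
  have := @c_subst i j U_(k)%MM (U_(k) *+ d.+1)%MM 1 ij.
  rewrite [(_ *+ 1)%MM]mulm1n -mulmS => -> //; rewrite ?U_out ?mulU_out ?mulU_neq0 //.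
  rewrite IH // expr1n mulr1 -[U_(j)%MM]mulm1n -(@c_merge i j k) ?U_out //.
  by rewrite -mulmS c_sqr.
have c_all i k m : i != k -> m i = 0%N -> m != 0%MM -> c i m = 1.
  (* The measure is the degree in the variables other than [k]; each merge moves the whole power of
     some [j] into [k]. *)
  move=> ik; have [s] := ubnP (mdeg m - m k).
  elim: s m => // s IH m lt_ms mi m0.
  have [/existsP[j /andP[jk mj]]|/existsPn no] :=
    boolP [exists j, (j != k) && (m j != 0%N)].
    have ij : i != j by apply: contraNneq mj => <-; rewrite mi.
    pose m' := [multinom (if l == j then 0 else m l)%N | l < n].
    have mE : m = (m' + U_(j) *+ m j)%MM.
      apply/mnmP => l; rewrite mnmDE mulmnE mnmE mnm1E eq_sym.
      by have [->|_] := eqVneq j l; rewrite ?mul1n ?mul0n ?addn0.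
    rewrite mE -(@c_merge i j k) -?mE //; last 2 first.
    - by rewrite mnmE (negPf ij).
    - by rewrite mnmE eqxx.
    have mjk : mdeg m = (mdeg m' + m j)%N by rewrite [in LHS]mE mdegD mdegMn mdeg1 mul1n.
    have m'k : m' k = m k by rewrite mnmE eq_sym (negPf jk).
    apply: IH; last 2 first.
    - by rewrite mnmDE mnmE (negPf ij) mi mulU_out.
    - by rewrite mnmD_eq0 (negPf (mulU_neq0 _ _)) ?andbF ?lt0n.
    rewrite mdegD mdegMn mdeg1 mnmDE mulmnE mnm1E eqxx !mul1n m'k.
    have : (m k <= mdeg m')%N by rewrite -m'k mdegE (bigD1 k) //= leq_addr.
    move: lt_ms mj; rewrite mjk; lia.
  have mE : m = (U_(k) *+ m k)%MM.
    apply/mnmP => l; rewrite mulmnE mnm1E; have [<-|kl] := eqVneq k l.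
      by rewrite mul1n.
    by have := no l; rewrite eq_sym kl mul0n /= => /negPn/eqP.
  have mk : m k != 0%N by apply: contra m0 => /eqP mk0; rewrite mE mk0 mulm0n.
  by rewrite mE; case: (m k) mk => // d _; apply: c_pow.
exists lam => // i m mi m0; have := @c_all i (o i) m; rewrite eq_sym o_neq.
move=> /(_ isT mi m0) /(canRL (mulfK _)); rewrite invr_eq0 mmap1_neq0 // invrK mul1r.
by move=> /(_ isT) <-; rewrite mulfK.
Qed.

End Cocycle.

(** * Images of shears under an automorphism fixing the torus *)

Section TorusFixing.
Variables (K : closedFieldType) (n : nat) (Phi : endo K n -> endo K n).
Implicit Types (i j k : 'I_n) (m q a : 'X_{1..n}) (lam : 'I_n -> K).
Hypothesis two_neq0 : 2%:R != 0 :> K.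
Hypothesis n_gt2 : (2 < n)%N.
Hypothesis Phi_aut : is_group_aut_aut0 Phi.
Hypothesis Phi_torus : forall lam, (forall i, lam i != 0) ->
  Phi (torus lam) = torus lam.

Local Notation shear i m c := (elem i (c%R *: 'X_[m])).

Lemma Phi_eid : Phi (eid K n) = eid K n.
Proof. by rewrite -torus1 Phi_torus // => i; rewrite oner_neq0. Qed.

Lemma Phi_ecomp f g : is_aut0 f -> is_aut0 g ->
  Phi (ecomp f g) = ecomp (Phi f) (Phi g).
Proof. by case: Phi_aut => _ + _ _; apply. Qed.

Lemma is_aut0_shear i m (c : K) :
  m i = 0%N -> m != 0%MM -> is_aut0 (shear i m c).
Proof. by move=> mi m0; apply/is_aut0_elem/elem_okX. Qed.

Lemma shearD i m (c c' : K) : m i = 0%N -> m != 0%MM ->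
  ecomp (shear i m c) (shear i m c') = shear i m (c + c').
Proof. by move=> mi m0; rewrite ecomp_elem ?scalerDl //; apply: elem_okX. Qed.

(** This is [torus_elem] after applying [Phi], which fixes the torus, compared coefficient by
    coefficient. *)
Lemma mcoeff_Phi_shear lam i m c j a :
    m i = 0%N -> m != 0%MM -> (forall k, lam k != 0) ->
  mmap1 lam a * (tnth (Phi (shear i m c)) j)@_a =
  lam j * (tnth (Phi (shear i m (c * mmap1 lam m / lam i))) j)@_a.
Proof.
move=> mi m0 l0; have := torus_elem c m (l0 i) => /(congr1 Phi).
rewrite !Phi_ecomp ?Phi_torus //; last 4 first.
- exact: is_aut0_shear.
- exact: is_aut0_torus.
- exact: is_aut0_torus.
- exact: is_aut0_shear.
move/(congr1 (fun f => (tnth f j)@_a)).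
rewrite !tnth_ecomp mcoeff_comp_torus tnth_torus comp_mpolyZ comp_mpolyXt.
by rewrite mcoeffZ.
Qed.

(* The shear, hence its image, commutes with the codimension-one subtorus
   [lam^m = lam_i]; the equations come from its one-parameter subgroups
   [lam_k = t], [lam_i = t ^ m_k]. *)
Lemma Phi_shear_exponents i m c j a k : m i = 0%N -> m != 0%MM ->
    (tnth (Phi (shear i m c)) j)@_a != 0 -> k != i ->
  (a k + m k * a i = if j == k then 1 else if j == i then m k else 0)%N.
Proof.
move=> mi m0 ga0 ki; apply: (@expr_inj_closed K) => t t0.
pose lam l := if l == k then t else if l == i then t ^+ m k else 1.
have l0 l : lam l != 0.
  by rewrite /lam; do 2!case: ifP => _ //; rewrite ?oner_neq0 ?expf_neq0.
have lamE q : mmap1 lam q = t ^+ q k * t ^+ (m k * q i).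
  rewrite /mmap1 (bigD1 k) //= (bigD1 i) 1?eq_sym //= big1 ?mulr1.
    by rewrite /lam !eqxx eq_sym (negPf ki) exprM.
  by move=> l /andP[lk li]; rewrite /lam (negPf lk) (negPf li) expr1n.
have := @mcoeff_Phi_shear lam i m c j a mi m0 l0.
rewrite !lamE mi muln0 mulr1 -exprD.
have -> : lam i = t ^+ m k by rewrite /lam eq_sym (negPf ki) eqxx.
rewrite mulfK ?expf_neq0 // => /(mulIf ga0) ->.
by rewrite /lam; case: eqP => // _; case: eqP.
Qed.

(** The exponent equations determine [a] from [a i]. For [j = i] they force [a i <= 1], as [m] is
    nonzero; for [j != i], a positive [a i] forces the transposed term. *)
Lemma Phi_shear_supp i m c j a : m i = 0%N -> m != 0%MM ->
    (tnth (Phi (shear i m c)) j)@_a != 0 ->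
  [\/ a = U_(j)%MM, j = i /\ a = m | m = U_(j)%MM /\ a = U_(i)%MM].
Proof.
move=> mi m0 ga0; have := Phi_shear_exponents mi m0 ga0.
have [k mk] := mnm_neq0P _ m0.
have ki : k != i by apply: contraNneq mk => ->; rewrite mi.
have [-> ai|ji aj] := eqVneq j i.
  have {}ai l : l != i -> (a l + m l * a i = m l)%N.
    by move=> li; rewrite ai // eq_sym (negPf li).
  have ak := ai k ki; case ai0: (a i) => [|[|r]].
  - constructor 2; split=> //; apply/mnmP => l; have [->|/ai] := eqVneq l i.
      by rewrite ai0 mi.
    by rewrite ai0 muln0 addn0.
  - constructor 1; apply/mnmP => l; rewrite mnm1E eq_sym.
    by have [->//|/ai] := eqVneq l i; rewrite ai0; lia.
  - by move: ak; rewrite ai0; nia.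
case ai0: (a i) => [|r].
  constructor 1; apply/mnmP => l; rewrite mnm1E.
  have [->|li] := eqVneq l i; first by rewrite ai0 (negPf ji).
  by have := aj l li; rewrite ai0 muln0 addn0 => ->; case: eqP.
have ml l : l != i -> l != j -> (m l = 0 /\ a l = 0)%N.
  by move=> li lj; have := aj l li; rewrite ai0 eq_sym (negPf lj); nia.
have kj : k = j by apply/eqP/negPn/negP => kj; have [] := ml k ki kj; lia.
have mj1 : [/\ m j = 1, r = 0 & a j = 0]%N.
  by have := aj j ji; rewrite ai0 eqxx -kj; split; nia.
case: mj1 => mj r0 aj0; constructor 3; split; apply/mnmP => l; rewrite mnm1E eq_sym.
  have [->//|lj] := eqVneq l j; have [->//|li] := eqVneq l i.
  by have [] := ml l li lj.
have [->|li] := eqVneq l i; first by rewrite ai0 r0.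
by have [->//|lj] := eqVneq l j; have [] := ml l li lj.
Qed.

(** The scalar b_(i,m), read off at parameter 1. *)
Definition shear_weight i m : K := (tnth (Phi (elem i 'X_[m])) i)@_m.

(* The diagonal coefficients [d] of [Phi (shear c)] do not depend on [c]: hence
   [d ^ 2 = d] by doubling [c], and [d ^ 2 = 1] by composing with [shear (- c)]. *)
Lemma Phi_shear_of i m : m i = 0%N -> m != 0%MM ->
    (forall c j, j != i -> (tnth (Phi (shear i m c)) j)@_U_(i) = 0) ->
  forall c, Phi (shear i m c) = shear i m (c * shear_weight i m).
Proof.
move=> mi m0 no_i; pose d j := (tnth (Phi (shear i m 1)) j)@_U_(j).
have mUi : m != U_(i)%MM by apply: contra_eq_neq mi => ->; rewrite mnm1E eqxx.
have Phi_c c j a : c != 0 -> a i = 0%N \/ (a = U_(j)%MM) ->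
    (tnth (Phi (shear i m c)) j)@_a =
    (if (j == i) && (a != U_(j)%MM) then c else 1) * (tnth (Phi (shear i m 1)) j)@_a.
  (* Since [m i = 0], conjugation by this torus element carries the parameter 1 to [c]. *)
  move=> c0 ha; pose lam l := if l == i then c^-1 else 1.
  have l0 l : lam l != 0.
    by rewrite /lam; case: ifP => _; rewrite ?invr_eq0 ?oner_neq0.
  have lamE q : mmap1 lam q = c^-1 ^+ q i.
    rewrite /mmap1 (bigD1 i) //= big1 ?mulr1 /lam ?eqxx //.
    by move=> l /negPf ->; rewrite expr1n.
  have := @mcoeff_Phi_shear lam i m 1 j a mi m0 l0.
  rewrite !lamE mi expr0 mulr1 /lam eqxx invrK mul1r.
  have [->|aj] := eqVneq a U_(j)%MM.
    rewrite andbF mnm1E; case: eqP => _; rewrite ?expr1 ?expr0 ?mul1r //.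
    by move/(mulfI _) => ->; rewrite ?invr_eq0.
  case: ha aj => [->|->]; last by rewrite eqxx.
  rewrite expr0 andbT mul1r => _ ->.
  by case: ifP => _; rewrite ?mul1r // mulVKf.
have formP c j : c != 0 -> tnth (Phi (shear i m c)) j =
    d j *: 'X_j + (if j == i then c * shear_weight i m else 0) *: 'X_[m].
  move=> c0; apply/mpolyP => a; rewrite mcoeffD !mcoeffZ !mcoeffX.
  have [<-|aj] := eqVneq U_(j)%MM a.
    rewrite Phi_c //; last by right.
    rewrite eqxx andbF mul1r mulr1; case: eqP => [->|_].
      by rewrite (negPf mUi) mulr0 addr0.
    by rewrite mul0r addr0.
  rewrite mulr0 add0r; case: (eqVneq m a) aj => [<-|am] aj.
    rewrite mulr1; case: (eqVneq j i) aj => [->|ji] aj; last first.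
      apply/eqP/negPn/negP => /(Phi_shear_supp mi m0)[e|[e _]|[_ e]].
      - by rewrite e eqxx in aj.
      - by rewrite e eqxx in ji.
      - by rewrite e eqxx in mUi.
    rewrite Phi_c ?eqxx //; last by left.
    by rewrite mUi /shear_weight scale1r.
  rewrite mulr0; apply/eqP/negPn/negP => ga0.
  case: (Phi_shear_supp mi m0 ga0) => [e|[_ e]|[e1 e]].
  - by rewrite e eqxx in aj.
  - by rewrite e eqxx in am.
  rewrite e no_i ?eqxx // in ga0; apply: contraNneq mUi => <-.
  by rewrite e1.
(* By [formP], composing rescales ['X_[m]] and adds multiples of it, so the coefficients of the
   variables just multiply. *)
have sqr c c' j : c != 0 -> c' != 0 ->
    (tnth (ecomp (Phi (shear i m c)) (Phi (shear i m c'))) j)@_U_(j) = d j ^+ 2.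
  move=> c0 c'0; rewrite tnth_ecomp (formP c') // comp_mpolyD !comp_mpolyZ.
  rewrite comp_mpolyXt (@comp_monomial_diag _ _ i _ _ d) //; last first.
    by move=> k /negPf ki; rewrite formP // ki scale0r addr0.
  rewrite formP // !mcoeffD !mcoeffZ mcoeffD !mcoeffZ !mcoeffX eqxx.
  have [->|_] := eqVneq j i; last by rewrite !mul0r !addr0 mulr1.
  by rewrite (negPf mUi) !mulr0 !addr0 mulr1.
have d1 j : d j = 1.
  have dd : d j ^+ 2 = d j.
    rewrite -(@sqr 1 1) ?oner_neq0 // -Phi_ecomp ?shearD //; try exact: is_aut0_shear.
    (* [formP] applies to the parameter [1 + 1] because 2 is nonzero in [K]. *)
    rewrite formP // mcoeffD !mcoeffZ !mcoeffX eqxx.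
    by have [->|_] := eqVneq j i; rewrite ?(negPf mUi) ?mulr0 ?mul0r addr0 mulr1.
  rewrite -dd -(@sqr 1 (-1)) ?oppr_eq0 ?oner_neq0 // -Phi_ecomp ?shearD //;
    try exact: is_aut0_shear.
  by rewrite subrr scale0r elem0 Phi_eid tnth_eid mcoeffX eqxx.
move=> c; have [->|c0] := eqVneq c 0.
  by rewrite mul0r scale0r elem0 Phi_eid.
apply: eq_from_tnth => j; rewrite formP // d1 scale1r tnth_elem.
by case: ifP => _; rewrite ?scale0r ?addr0.
Qed.

(** Only the last term is free of ['X_j]. In a binomial expansion its binomial coefficient is 1, so
    nothing is lost modulo the characteristic. *)
Lemma mcoeff_subst_top (A : nat -> K) j m q r : m j = 0%N -> q j = 0%N ->
  (\sum_(k < r.+1) A k *: 'X_[m + U_(j) *+ (r - k) + q *+ k])@_(m + q *+ r) = A r.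
Proof.
move=> mj qj; rewrite raddf_sum (bigD1 ord_max) //= mcoeffZ mcoeffX subnn.
rewrite mulm0n addm0 eqxx mulr1 big1 ?addr0 // => k kr.
rewrite mcoeffZ mcoeffX; case: eqP => [/mnmP/(_ j)|]; last by rewrite mulr0.
rewrite !mnmDE !mulmnE mnm1E eqxx mj qj !mul0n mul1n addn0 => /eqP.
rewrite subn_eq0 => rk; case/eqP: kr; apply: val_inj => /=; apply/eqP.
by rewrite eqn_leq rk -ltnS ltn_ord.
Qed.

(** A zero weight would send a nontrivial shear to the identity, against injectivity. *)
Lemma shear_weight_neq0 i m : m i = 0%N -> m != 0%MM ->
    (forall c, Phi (shear i m c) = shear i m (c * shear_weight i m)) ->
  shear_weight i m != 0.
Proof.
move=> mi m0 PhiE; apply/eqP => w0; have := PhiE 1.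
rewrite w0 mulr0 scale0r elem0 -Phi_eid -(elem0 K i); case: Phi_aut => _ _ inj _.
move/inj => /(_ (is_aut0_shear _ mi m0)).
move=> /(_ (is_aut0_elem (elem_ok0 K i))) /elem_inj /(congr1 (mcoeff m)).
by rewrite mcoeffZ mcoeffX eqxx mcoeff0 mulr1 => /eqP; rewrite oner_eq0.
Qed.

Lemma Phi_shear i m c : m i = 0%N -> m != 0%MM ->
  Phi (shear i m c) = shear i m (c * shear_weight i m).
Proof.
(* For a nonlinear exponent the transposed term of [Phi_shear_supp] cannot occur. *)
have nonlin q : (forall l, q != U_(l)%MM) -> q i = 0%N -> q != 0%MM ->
    forall c, Phi (shear i q c) = shear i q (c * shear_weight i q).
  move=> qU qi q0; apply: Phi_shear_of => // {}c j ji.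
  apply/eqP/negPn/negP => /(Phi_shear_supp qi q0)[e|[e _]|[e _]].
  - by move/mnmP/(_ i): e; rewrite !mnm1E eqxx (negPf ji).
  - by rewrite e eqxx in ji.
  - by have := qU j; rewrite e eqxx.
move=> mi m0; have [/mdeg1P[l /eqP mE]|m1] := boolP (mdeg m == 1%N); last first.
  by apply: nonlin => // l; apply: contraNneq m1 => ->; rewrite mdeg1.
apply: Phi_shear_of => // {}c j ji.
(* [shear i m c] commutes with the nonlinear [elem i 'X_k^2], which [Phi] only
   rescales; a term in ['X_i] off the [i]-th component breaks this. *)
have [k /andP[ki kl]] := exists_third i l n_gt2.
pose q : 'X_{1..n} := (U_(k) *+ 2)%MM.
have qi : q i = 0%N by rewrite mulmnE mnm1E (negPf ki).
have q2 : mdeg q = 2 by rewrite mdegMn mdeg1.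
have q0 : q != 0%MM by rewrite -mdeg_eq0 q2.
have PhiV : forall c', Phi (shear i q c') = shear i q (c' * shear_weight i q).
  apply: nonlin => // l'; apply/eqP => /(congr1 mdeg); rewrite q2.
  by rewrite mdeg1.
have w0 := shear_weight_neq0 qi q0 PhiV.
set gi := (tnth _ j)@_U_(i).
have gE : tnth (Phi (shear i m c)) j =
    (tnth (Phi (shear i m c)) j)@_U_(j) *: 'X_j + gi *: 'X_i.
  rewrite /gi; apply/mpolyP => a; rewrite mcoeffD !mcoeffZ !mcoeffX.
  have [<-|aj] := eqVneq U_(j)%MM a.
    have -> : (U_(i)%MM == U_(j)%MM :> 'X_{1..n}) = false.
      by apply/eqP => /mnmP/(_ i); rewrite !mnm1E eqxx (negPf ji).
    by rewrite mulr1 mulr0 addr0.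
  have [<-|ai] := eqVneq U_(i)%MM a; first by rewrite mulr1 mulr0 add0r.
  rewrite !mulr0 addr0; apply/eqP/negPn/negP => /(Phi_shear_supp mi m0).
  case=> [e|[e _]|[_ e]].
  - by rewrite e eqxx in aj.
  - by rewrite e eqxx in ji.
  - by rewrite e eqxx in ai.
have : ecomp (Phi (shear i q 1)) (Phi (shear i m c)) =
       ecomp (Phi (shear i m c)) (Phi (shear i q 1)).
  rewrite -!Phi_ecomp; try exact: is_aut0_shear.
  by rewrite !ecomp_elem 1?addrC //; apply: elem_okX.
(* At [q] the left side has [gi] times the nonzero weight of [q], the right side 0. *)
move/(congr1 (fun f => (tnth f j)@_q)).
rewrite PhiV mul1r !tnth_ecomp tnth_elem (negPf ji) comp_mpolyXt gE.
rewrite comp_mpolyD !comp_mpolyZ !comp_mpolyXt !tnth_elem eqxx (negPf ji).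
rewrite !mcoeffD !mcoeffZ !mcoeffD !mcoeffZ !mcoeffX eqxx.
have qU l' : (U_(l')%MM == q) = false.
  by apply/eqP => /(congr1 mdeg); rewrite q2 mdeg1.
rewrite !qU !mulr0 !add0r mulr1 => /eqP.
by rewrite mulf_eq0 (negPf w0) orbF => /eqP.
Qed.

(** * From shears to all elementary automorphisms *)

(** For fixed [i], composition of elementary automorphisms is addition of polynomials. The general
    index list serves both supports and binomial expansions. *)
Lemma Phi_elem_sum (I : eqType) (s : seq I) i (F : I -> K) (M : I -> 'X_{1..n}) :
    (forall x, x \in s -> M x i = 0%N) -> (forall x, x \in s -> M x != 0%MM) ->
  Phi (elem i (\sum_(x <- s) F x *: 'X_[M x])) =
  elem i (\sum_(x <- s) (F x * shear_weight i (M x)) *: 'X_[M x]).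
Proof.
elim: s => [|x s IH] Mi M0; first by rewrite !big_nil elem0 Phi_eid.
have [xi x0] := (Mi x (mem_head x s), M0 x (mem_head x s)).
have {}Mi y : y \in s -> M y i = 0%N by move=> ys; rewrite Mi // inE ys orbT.
have {}M0 y : y \in s -> M y != 0%MM by move=> ys; rewrite M0 // inE ys orbT.
have ok (G : I -> K) : elem_ok i (\sum_(y <- s) G y *: 'X_[M y]).
  rewrite big_seq; elim/big_ind: _ => [|P Q|y ys].
  - exact: elem_ok0.
  - exact: elem_okD.
  - by apply: elem_okX; rewrite ?Mi ?M0.
rewrite !big_cons -!ecomp_elem // Phi_ecomp ?Phi_shear ?IH //.
  exact: is_aut0_shear.
exact: is_aut0_elem.
Qed.

(** Apply [Phi] to the conjugation relation [elem_conj], expand both sides by the binomial theorem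
    and compare the coefficients at [m + q *+ r]. *)
Lemma shear_weight_subst i j m q r : i != j ->
    m i = 0%N -> m j = 0%N -> q i = 0%N -> q j = 0%N -> q != 0%MM ->
    (m + U_(j) *+ r)%MM != 0%MM ->
  shear_weight i (m + q *+ r)%MM =
  shear_weight i (m + U_(j) *+ r)%MM * shear_weight j q ^+ r.
Proof.
move=> ij mi mj qi qj q0 mr0.
have ji : j != i by rewrite eq_sym.
pose M (k : nat) : 'X_{1..n} := (m + U_(j) *+ (r - k) + q *+ k)%MM.
have Mi (k : nat) : M k i = 0%N.
  by rewrite !mnmDE !mulmnE mnm1E (negPf ji) mi qi !mul0n.
have M0 (k : nat) : (k < r.+1)%N -> M k != 0%MM.
  rewrite ltnS => kr; apply: contra mr0; rewrite !mnmD_eq0 => /andP[/andP[-> ]] /=.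
  rewrite -!mdeg_eq0 !mdegMn mdeg1 !mul1n muln_eq0 mdeg_eq0 (negPf q0) /=.
  by move=> rk /eqP k0; rewrite k0 subn0 in rk.
have mri : (m + U_(j) *+ r)%MM i = 0%N.
  by rewrite mnmDE mulmnE mnm1E (negPf ji) mi.
have okq (c : K) : elem_ok i (c *: 'X_[q]) by apply: elem_okX.
have := comp_monomial_elem (1 : K) q r mj; set C := (LHS) => CE.
have okC : elem_ok i C.
  rewrite CE; elim/big_ind: _ => [|P Q|k _].
  - exact: elem_ok0.
  - exact: elem_okD.
  - by apply: elem_okX; [exact: (Mi k) | exact: (M0 k)].
have auC : is_aut0 (elem i C) by apply: is_aut0_elem.
have auq : is_aut0 (shear j q (1 : K)) by apply: is_aut0_shear.
have aum : is_aut0 (elem i 'X_[m + U_(j) *+ r] : endo K n).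
  by apply: is_aut0_elem; rewrite -['X_[_]]scale1r; apply: elem_okX.
have PhiC : Phi (elem i C) = elem i (\sum_(k < r.+1)
    ((1 ^+ k *+ 'C(r, k)) * shear_weight i (M k)) *: 'X_[M k]).
  by rewrite CE Phi_elem_sum // => k _; [exact: (Mi k) | exact: (M0 k)].
have Phim : Phi (elem i 'X_[m + U_(j) *+ r]) =
    shear i (m + U_(j) *+ r)%MM (shear_weight i (m + U_(j) *+ r)%MM).
  by rewrite -[in RHS](mul1r (shear_weight _ _)) -Phi_shear // scale1r.
have /(congr1 Phi) : ecomp (shear j q (1 : K)) (elem i 'X_[m + U_(j) *+ r]) =
    ecomp (elem i C) (shear j q 1) by exact: elem_conj.
rewrite (Phi_ecomp auq aum) (Phi_ecomp auC auq) PhiC Phim Phi_shear // mul1r.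
rewrite elem_conj //.
move/(congr1 (fun f => tnth f i)); rewrite !tnth_ecomp !tnth_elem (negPf ij).
rewrite !comp_mpolyXt !tnth_elem eqxx => /addrI.
rewrite comp_mpolyZ comp_monomial_elem // => /(congr1 (mcoeff (m + q *+ r)%MM)).
rewrite mcoeffZ.
rewrite (mcoeff_subst_top (fun k : nat => shear_weight j q ^+ k *+ 'C(r, k))) //.
rewrite (mcoeff_subst_top (fun k : nat => (1 ^+ k *+ 'C(r, k)) * shear_weight i (M k))) //.
by rewrite binn !mulr1n expr1n mul1r /M subnn mulm0n addm0.
Qed.

(** The weights from [cocycle_coboundary] are the scalars by which conjugation by [torus lam] acts
    on monomials; the intertwining form avoids inverses. *)
Lemma Phi_elem_torus : exists2 lam : 'I_n -> K, (forall k, lam k != 0) &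
  forall i P, elem_ok i P ->
    ecomp (torus lam) (elem i P) = ecomp (Phi (elem i P)) (torus lam).
Proof.
have [|lam l0 wE] := @cocycle_coboundary K n shear_weight n_gt2 _ shear_weight_subst.
  move=> i m mi m0; apply: shear_weight_neq0 => // c; exact: Phi_shear.
exists lam => // i P [Pi P0].
have Pm m : m \in msupp P -> m != 0%MM.
  by move=> mP; apply: contraTneq mP => ->; rewrite mcoeff_msupp P0 eqxx.
rewrite [P in Phi (elem i P)]mpolyE Phi_elem_sum //.
apply: eq_from_tnth => j; rewrite !tnth_ecomp tnth_torus comp_mpolyZ.
rewrite comp_mpolyXt !tnth_elem; have [->|ji] := eqVneq j i; last first.
  by rewrite comp_mpolyXt tnth_torus.
rewrite comp_mpolyD comp_mpolyXt tnth_torus scalerDr; congr (_ + _).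
rewrite comp_mpolyEX scaler_sumr; apply: eq_big_seq => m mP.
rewrite (@comp_monomial_diag _ _ i _ _ lam) ?Pi //; last first.
  by move=> k _; rewrite tnth_torus.
rewrite !scalerA wE ?Pi ?Pm //; congr (_ *: _).
by field.
Qed.

End TorusFixing.

(** * Conclusion with a diagonal matrix *)

Lemma linaut_diag (K : fieldType) (n : nat) (d : 'rV[K]_n) :
  linaut (diag_mx d) = torus (d 0).
Proof.
apply: eq_from_tnth => i; rewrite tnth_torus tnth_mktuple (bigD1 i) //=.
rewrite big1 => [|j ji]; first by rewrite mxE eqxx mulr1n addr0.
by rewrite mxE eq_sym (negPf ji) scale0r.
Qed.

Theorem mainTheorem1 (K : closedFieldType) (p n : nat)
  (hp : p \in [pchar K]) (hp2 : p != 2%N) (hn : (3 < n)%N)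
  (Phi : endo K n -> endo K n)
  (hPhi : is_group_aut_aut0 Phi)
  (htorus : forall lam : 'I_n -> K, (forall i, lam i != 0) ->
      Phi (torus lam) = torus lam) :
  exists2 S : 'M[K]_n, S \in unitmx &
    forall (i : 'I_n) (P : {mpoly K[n]}), elem_ok i P ->
      ecomp (ecomp (linaut S) (Phi (elem i P))) (linaut (invmx S)) = elem i P.
Proof.
have two_neq0 : 2%:R != 0 :> K.
  rewrite -(dvdn_pcharf hp) dvdn_prime2 //; exact: pcharf_prime hp.
have [lam l0 lamP] := Phi_elem_torus two_neq0 (ltnW hn) hPhi htorus.
(* [Phi] acts as conjugation by [torus lam], so the inverse diagonal matrix undoes it. *)
pose D := diag_mx (\row_k (lam k)^-1); pose E := diag_mx (\row_k lam k).
have DE : D *m E = 1%:M.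
  by rewrite mulmx_diag; apply/matrixP => k l; rewrite !mxE mulVf.
have [D_unit E_unit] := mulmx1_unit DE.
exists D => // i P okP.
have -> : invmx D = E by rewrite -[LHS]mulmx1 -DE mulKmx.
rewrite !linaut_diag; apply: eq_from_tnth => j.
have /(congr1 (fun f => tnth f j)) := lamP i P okP.
rewrite !tnth_ecomp !tnth_torus !mxE !comp_mpolyZ !comp_mpolyXt tnth_ecomp => e.
rewrite -comp_mpolyZ -e; apply/mpolyP => a.
rewrite !mcoeff_comp_torus mulrA -[RHS]mul1r; congr (_ * _).
rewrite /mmap1 -big_split big1 //= => k _.
by rewrite -exprMn mxE mulVf ?expr1n.
Qed.
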